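(* Let $G$ be a finite connected graph cellularly embedded on a compact orientable surface $\Sigma$, and let $BRT_G(x,y,z)$ be its Bollobás–Riordan–Tutte polynomial. Let $D_L$ be the (alternating) link diagram on $\Sigma$ having $G$ as a checkerboard graph (the medial link diagram of $G$), and let $c$ be the number of components of $D_L$. Then $$|BRT_G(-2,-2,1/4)| = 2^{c-1}.$$
   Context: Graphs may have loops and multiple edges. A graph is cellularly embedded on a surface if every face (component of the complement) is an open disk. For a spanning subgraph $H\subseteq G$ (all vertices of $G$, any subset of edges) let $v(H), e(H), k(H)$ be the numbers of vertices, edges and connected components of $H$, and let $f(H)$ be the number of faces of $H$ regarded as a ribbon graph, i.e. the number of boundary components of a regular neighbourhood of $H$ in $\Sigma$. The nullity is $n(H)=e(H)-v(H)+k(H)$ and the genus is $g(H)=\frac{2k(H)-v(H)+e(H)-f(H)}{2}$. The Bollobás–Riordan–Tutte polynomial is $$BRT_G(x,y,z)=\sum_{H\subseteq G} x^{k(H)-k(G)}\,y^{n(H)}\,z^{g(H)},$$ the sum being over all spanning subgraphs $H$ of $G$. (In this normalization the variable $x$ is shifted by one relative to the original definition, so that $BRT_G(x-1,y-1,1)=T_G(x,y)$ is the Tutte polynomial.) The diagram $D_L$ is obtained by placing a crossing at the midpoint of each edge of $G$, and joining crossings by arcs that run alongside the edges: for each corner of a face (a pair of consecutive edge-ends around a vertex) one arc joins the crossings on the two edges meeting at that corner. Its underlying 4-valent graph on $\Sigma$ is the medial graph of $G$; the faces of the medial graph correspond to the vertices and the faces of $G$ (black and white in the checkerboard coloring), and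 each crossing is incident to the two ends of the corresponding edge of $G$. (If $G$ is a single vertex without edges, the medial graph is one circle without crossings.) The number of components of $D_L$ is the number of closed curves traced out by going straight ahead (leaving along the opposite arc) at every crossing; it does not depend on the over/under information. *)

(* Defs.v *)
From mathcomp Require Import all_boot all_order all_fingroup all_algebra.

Set Implicit Arguments.
Unset Strict Implicit.
Unset Printing Implicit Defensive.

Import GRing.Theory Num.Theory.
Local Open Scope ring_scope.

(* A finite graph (loops, multiple edges and isolated vertices allowed) that is
   cellularly embedded on a closed oriented surface, given by its rotation
   system.  The half-edge (e, b) is one of the two ends of the edge e, [org]
   is the vertex it is attached to, and [rot] sends a half-edge to the next one
   counterclockwise around that vertex; [org_rot] says that the half-edges at a
   given vertex form a single cycle of [rot].  By Heffter-Edmonds, when the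
   graph is connected these data are the same thing as a cellular embedding on
   a compact oriented surface, up to homeomorphism: the surface is obtained by
   gluing a disk to each boundary component of the ribbon graph. *)
Record embedded_graph := EmbeddedGraph {
  vtx : finType;
  edge : finType;
  org : edge * bool -> vtx;
  rot : {perm edge * bool};
  org_rot : forall d d', (org d == org d') = (d' \in porbit rot d)
}.

Section EmbeddedGraph.
Variable G : embedded_graph.

Definition halfedge : finType := (edge G * bool)%type.

Definition opp (d : halfedge) : halfedge := (d.1, ~~ d.2).

Definition isolated : {set vtx G} := [set v | v \notin codom (@org G)].

(* A spanning subgraph is given by its set of edges H : {set edge G}. *)
Section SpanningSubgraph.
Variable H : {set edge G}.

Definition adj : rel (vtx G) := fun v w =>
  [exists d : halfedge, [&& d.1 \in H, org d == v & org (opp d) == w]].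

Definition nb_vertices : nat := #|vtx G|.
Definition nb_edges : nat := #|H|.
Definition nb_components : nat := n_comp adj predT.

(* Walk along the boundary of a regular neighbourhood of H, counterclockwise
   around the vertices.  On reaching a half-edge d: if its edge is in H, follow
   the ribbon to the other end [opp d] and go on to the half-edge after
   [opp d]; otherwise pass by d to the next half-edge at the same vertex. *)
Definition boundary_step (d : halfedge) : halfedge :=
  rot G (if d.1 \in H then opp d else d).

(* A vertex isolated in H but not in G is counted in the first summand, as a
   cycle of [rot]; one isolated in G carries no half-edge. *)
Definition nb_faces : nat :=
  (fcard boundary_step predT + #|isolated|)%N.

Definition nullity : int :=
  nb_edges%:Z - nb_vertices%:Z + nb_components%:Z.

(* The division is exact: the numerator is even (and nonnegative) because H
   is a ribbon graph with orientable neighbourhood. *)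
Definition genus : int :=
  ((2 * nb_components%:Z - nb_vertices%:Z + nb_edges%:Z - nb_faces%:Z) %/ 2)%Z.

End SpanningSubgraph.

Definition connected_graph : Prop := nb_components [set: edge G] = 1%N.

(* All the exponents are in fact nonnegative; they are taken in int so that
   the subtractions are not truncated. *)
Definition BRT (R : comUnitRingType) (x y z : R) : R :=
  \sum_(H : {set edge G})
     x ^ ((nb_components H)%:Z - (nb_components [set: edge G])%:Z)
     * y ^ nullity H * z ^ genus H.

(* Half-arcs of the medial diagram, seen from the crossing at the midpoint of
   an edge: (d, true) leaves along the end d of that edge on its
   counterclockwise side, i.e. towards the corner (d, rot d), and (d, false) on
   its clockwise side, i.e. towards the corner (rot^-1 d, d). *)
Definition halfarc : finType := (halfedge * bool)%type.

Definition medial_arc (u : halfarc) : halfarc :=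
  if u.2 then (rot G u.1, false) else ((rot G)^-1%g u.1, true).

(* Next half-arc counterclockwise around the same crossing. *)
Definition medial_rot (u : halfarc) : halfarc :=
  if u.2 then (u.1, false) else (opp u.1, true).

(* The opposite half-arc at a 4-valent crossing is two steps further. *)
Definition straight_ahead (u : halfarc) : halfarc := medial_rot (medial_rot u).

Definition same_strand : rel halfarc := fun u w =>
  (w == medial_arc u) || (w == straight_ahead u).

(* An isolated vertex contributes one circle without crossings. *)
Definition nb_link_components : nat :=
  (n_comp same_strand predT + #|isolated|)%N.

End EmbeddedGraph.

(* Main.v *)
(** Since (1/4)^g = (-2)^(-2g), the summand of a spanning subgraph H collapses
    to (-2)^(f(H) - 1).  The numbers f(H) and v(G) + e(H) have the same parity,
    because f(H) counts the cycles of the product of [rot] with e(H)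
    transpositions; so up to a global sign and factor the value is the sum of
    (-1)^e(H) 2^f(H).  Now 2^f(H) is the number of 2-colorings of the
    half-edges that are constant along the boundary of H.  Exchanging the two
    sums, the sum over H of a fixed coloring factors over the edges (in the
    language of tensors, each edge contributes id - swap = the projector on the
    singlet of C^2 x C^2), and it vanishes unless the coloring changes at every
    edge crossed by a strand of the medial diagram.  The surviving colorings
    all have the same sign, and there are two of them for each strand. *)
Require Import Defs.
From mathcomp Require Import all_boot all_order all_fingroup all_algebra.
From mathcomp Require Import zify.
Import GRing.Theory Num.Theory.
Local Open Scope ring_scope.

(** * Permutation orbits and invariant colorings *)

Lemma fconnect_porbit (T : finType) (s : {perm T}) x y :
  fconnect s x y = (y \in porbit s x).
Proof.
apply/idP/porbitP => [/iter_findex <- | [i ->]].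
  by exists (findex s x y); rewrite permX.
by rewrite permX fconnect_iter.
Qed.

Lemma card_porbits (T : finType) (s : {perm T}) : #|porbits s| = fcard s predT.
Proof.
have sym_s : connect_sym (frel s) := fconnect_sym (@perm_inj _ s).
have repr x : porbit s (froot s x) = porbit s x.
  by apply/eqP; rewrite eq_porbit_mem -fconnect_porbit connect_root.
have -> : fcard s predT = #|[set porbit s x | x in froots s]|.
  rewrite card_in_imset => [|x y /eqP rx /eqP ry exy].
    by apply: eq_card => x; rewrite inE /= andbT.
  rewrite -rx -ry; apply/(fingraph.rootP sym_s).
  by rewrite fconnect_porbit exy porbit_id.
apply: eq_card => A; apply/imsetP/imsetP => -[x _ ->]; last by exists x.
by exists (froot s x); rewrite ?repr // inE roots_root.
Qed.

(** An invariant coloring is determined by its values on the component roots, and these are free. *)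
Lemma card_invariant_coloring (T : finType) (e : rel T) : connect_sym e ->
  #|[set f : {ffun T -> bool} | [forall x, forall y, e x y ==> (f x == f y)]]|
  = (2 ^ n_comp e predT)%N.
Proof.
move=> sym_e.
(* Colorings of the roots are encoded as total functions that are [false] elsewhere; [ext] spreads
   them over the components. *)
rewrite -card_bool -(card_pffun_on false _ predT).
pose ext (g : {ffun T -> bool}) := [ffun x => g (fingraph.root e x)].
rewrite -[RHS](@card_in_imset _ _ ext); last first.
  move=> g h /pffun_onP[sg _] /pffun_onP[sh _] /ffunP egh; apply/ffunP => x.
  have [rx|nrx] := boolP (roots e x).
    by have := egh x; rewrite !ffunE (eqP rx).
  have zero k : false.-support k \subset predI (roots e) predT -> k x = false.
    move=> sk; apply/negbTE; apply: contra nrx => kx.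
    by have /(subsetP sk)/andP[] : x \in false.-support k by rewrite inE kx.
  by rewrite !zero.
apply: eq_card => f; rewrite inE; apply/idP/imsetP => [invf | [g _ ->]].
  have f_root x : f (fingraph.root e x) = f x.
    suff: subpred (connect e x) [pred y | f y == f x].
      by move/(_ _ (connect_root e x))/eqP.
    move=> y /connectP[p + ->]; elim: p x => [|z p IHp] x //= /andP[xz /IHp].
    by move/forallP/(_ x)/forallP/(_ z)/implyP/(_ xz)/eqP: invf => ->.
  exists [ffun x => roots e x && f x].
    apply/pffun_onP; split=> //; apply/subsetP=> x; rewrite inE ffunE.
    by rewrite eqbF_neg negbK inE /= => /andP[->].
  by apply/ffunP => x; rewrite !ffunE roots_root //= f_root.
apply/forallP => x; apply/forallP => y; apply/implyP => exy.
by rewrite !ffunE (fingraph.rootP sym_e (connect1 exy)).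
Qed.

(* The orbits of p * q come in pairs exchanged by p: if p x = s^i x, then s^(i/2) x
   gives a fixed point of p or, for odd i, one of q. *)
Lemma fixfree_involutions_bicoloring (T : finType) (p q : {perm T}) :
  (forall x, p (p x) = x) -> (forall x, q (q x) = x) ->
  (forall x, p x != x) -> (forall x, q x != x) ->
  exists f : {ffun T -> bool},
    (forall x, f (p x) = ~~ f x) /\ (forall x, f (q x) = ~~ f x).
Proof.
move=> pK qK p_free q_free.
have [s sE] : exists s : {perm T}, forall x, s x = q (p x).
  by exists (p * q)%g => x; rewrite permM.
(* [p] conjugates [s] to its inverse. *)
have shift i x : (s ^+ i)%g (p ((s ^+ i)%g x)) = p x.
  elim: i x => [|i IHi] x; first by rewrite expg0 !perm1.
  by rewrite {1}expgSr expgS !permM IHi !sE pK qK.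
have p_out x : p x \notin porbit s x.
  apply/porbitP => -[i]; rewrite -[i]odd_double_half -addnn addnCA.
  rewrite !expgD !permM -(shift i./2 x) => /perm_inj /eqP; apply/negP.
  by case: (odd i); rewrite ?expg1 ?expg0 ?perm1 ?sE // eq_sym q_free.
have porbit_s x : porbit s (s x) = porbit s x by apply: (porbit_perm s 1).
have porbit_ps x : porbit s (p (s x)) = porbit s (p x).
  by rewrite -[p x](shift 1) expg1 porbit_s.
(* Any total order on orbits selects one from each pair swapped by [p]; as [q x = s (p x)], [q]
   swaps the same pairs. *)
exists [ffun x => (enum_rank (porbit s x) < enum_rank (porbit s (p x)))%N].
have fp x : (enum_rank (porbit s (p x)) < enum_rank (porbit s (p (p x))))%N =
    ~~ (enum_rank (porbit s x) < enum_rank (porbit s (p x)))%N.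
  rewrite pK -leqNgt [RHS]leq_eqVlt.
  rewrite (inj_eq val_inj) (inj_eq enum_rank_inj) eq_porbit_mem.
  by rewrite (negPf (p_out x)).
split=> x; rewrite !ffunE; first exact: fp.
by rewrite -[in q x](pK x) -sE porbit_s porbit_ps fp.
Qed.

Section MedialDiagram.
Variable G : embedded_graph.
Local Notation D := (halfedge G).
Implicit Types (d : D) (H : {set edge G}).
Local Notation opp := (@Defs.opp G).
Local Notation rot := (Defs.rot G).

Lemma oppK d : opp (opp d) = d.
Proof. by case: d => e b; rewrite /opp /= negbK. Qed.

Lemma opp_neq d : opp d != d.
Proof. by case: d => e b; rewrite /opp xpair_eqE eqxx; case: b. Qed.

(** * Parity of the number of faces and the summand of a subgraph *)

Definition flip_in H d : D := if d.1 \in H then opp d else d.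

Lemma flip_inK H : involutive (flip_in H).
Proof.
move=> d; rewrite {2}/flip_in; case: ifP => eH; rewrite /flip_in /= eH //.
exact: oppK.
Qed.

Definition flip_perm H : {perm D} := perm (inv_inj (flip_inK H)).

(** [flip_perm H] is a product of disjoint transpositions, one per edge of [H]; the induction splits
    off one edge. *)
Lemma odd_flip_perm H : flip_perm H = odd #|H| :> bool.
Proof.
elim: {H}#|H| {-2}H (erefl #|H|) => [|n IHn] H cardH.
  rewrite cardH -[RHS](@odd_perm1 D); congr odd_perm; apply/permP => d.
  by rewrite permE perm1 /flip_in (cards0_eq cardH) inE.
have /card_gt0P[e eH] : (0 < #|H|)%N by rewrite cardH.
have cardHe : #|H :\ e| = n by move: cardH; rewrite (cardsD1 e) eH => -[].
rewrite cardH /= -cardHe -IHn // -[LHS]negbK; congr (~~ _).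
rewrite -[~~ _]/(true (+) _).
have -> : true = ((e, true) != (e, false) :> D) by rewrite xpair_eqE eqxx.
rewrite -odd_mul_tperm; congr odd_perm; apply/permP => -[e' b].
rewrite permM !permE /= !xpair_eqE /flip_in /Defs.opp !inE.
by case: (eqVneq e' e) => [->|]; case: b; rewrite /= ?eH.
Qed.

Lemma boundary_stepE H d : boundary_step H d = (flip_perm H * rot)%g d.
Proof. by rewrite permM permE. Qed.

(** Non-isolated vertices correspond to cycles of [rot], which are the fibers of [org]. *)
Lemma card_vtx : #|vtx G| = (#|porbits rot| + #|isolated G|)%N.
Proof.
rewrite -(cardC (mem (codom (@org G)))); congr (_ + _)%N; last first.
  by apply: eq_card => v; rewrite !inE.
have fib d : [set d' | org d' == org d] = porbit rot d.
  by apply/setP => d'; rewrite inE eq_sym org_rot.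
pose fiber v := [set d : D | org d == v].
rewrite -(@card_in_imset _ _ fiber) => [|_ _ /codomP[d ->] /codomP[d' ->]].
  apply: eq_card => A; apply/imsetP/imsetP => [[_ /codomP[d ->] ->]|[d _ ->]].
    by exists d => //; apply: fib.
  by exists (org d); rewrite ?codom_f // -fib.
by move/setP/(_ d); rewrite !inE eqxx => /esym/eqP.
Qed.

Lemma odd_nb_faces H : odd (nb_faces H) = odd #|vtx G| (+) odd #|H|.
Proof.
rewrite /nb_faces card_vtx !oddD (eq_fcard (boundary_stepE H)) -card_porbits.
have := odd_permM (flip_perm H) rot; rewrite odd_flip_perm /odd_perm.
by do 5 case: (odd _).
Qed.

Lemma BRT_term H : connected_graph G ->
  (- 2 : rat) ^ ((nb_components H)%:Z - (nb_components [set: edge G])%:Z)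
    * (- 2) ^ nullity H * (1 / 4) ^ genus H = (- 2) ^ ((nb_faces H)%:Z - 1).
Proof.
move=> ->; have nz2 : (- 2 : rat) != 0 by [].
have -> : (1 / 4 : rat) = (- 2) ^ (- 2%:Z) by [].
rewrite exprz_exp -!expfzDr //; congr (_ ^ _).
set g2 := (2 * (nb_components H)%:Z - (nb_vertices G)%:Z + (nb_edges H)%:Z
  - (nb_faces H)%:Z).
have : (2 %| g2)%Z.
  have even_sum : odd (nb_vertices G + nb_edges H + nb_faces H) = false.
    by rewrite oddD odd_nb_faces oddD addbb.
  apply/dvdzP.
  (* [g2] is twice [k + e] minus [v + e + f], and the latter sum is even. *)
  exists ((nb_components H)%:Z + (nb_edges H)%:Z
    - ((nb_vertices G + nb_edges H + nb_faces H)./2)%:Z).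
  rewrite /g2; lia.
rewrite /genus -/g2 => /divzK def_g2.
have -> : - 2%:Z * (g2 %/ 2)%Z = - g2 by rewrite mulNr mulrC def_g2.
by rewrite /g2 /nullity; lia.
Qed.

(** * State sum over colorings of the half-edges *)

Lemma fcard_boundary_coloring H :
  (2 ^ fcard (boundary_step H) predT)%N =
  #|[set f : {ffun D -> bool} | [forall d, f (boundary_step H d) == f d]]|.
Proof.
rewrite -card_invariant_coloring; last first.
  apply: fconnect_sym => d d'; rewrite !boundary_stepE; exact: perm_inj.
apply: eq_card => f; rewrite !inE; apply/forallP/forallP => invf d.
  have /forallP/(_ (boundary_step H d))/implyP := invf d.
  by rewrite eq_sym; apply => /=.
by apply/forallP => d'; apply/implyP => /eqP <-; rewrite eq_sym.
Qed.

(** [f d] and [f (rot d)] are the colors of the clockwise and counterclockwise half-arcs at [d];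
    both must change when a strand goes through the crossing. *)
Definition alternating (f : {ffun D -> bool}) :=
  [forall d, (f (opp d) != f d) && (f (rot (opp d)) != f (rot d))].

(** For alternating [f] it is 1 if leaving [e] out of [H] is compatible with [f], and -1 if
    including it is. *)
Definition edge_sign (f : {ffun D -> bool}) (e : edge G) : rat :=
  (-1) ^+ (f (e, true) (+) f (rot (e, true))).

Lemma state_sum_alternating :
  \sum_(H : {set edge G}) (-1) ^+ #|H| * 2 ^+ fcard (boundary_step H) predT
  = \sum_(f | alternating f) \prod_e edge_sign f e.
Proof.
(* Invariance under the boundary walk is local: [kept] at edges outside [H], [flipped] at edges of
   [H]. *)
pose kept (f : {ffun D -> bool}) e := (f (rot (e, true)) == f (e, true)) &&
  (f (rot (e, false)) == f (e, false)).
pose flipped (f : {ffun D -> bool}) e := (f (rot (e, true)) == f (e, false)) &&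
  (f (rot (e, false)) == f (e, true)).
transitivity (\sum_(H : {set edge G}) \sum_(f : {ffun D -> bool})
    \prod_e (if e \in H then - (flipped f e)%:R else (kept f e)%:R : rat)).
  apply: eq_bigr => H _.
  rewrite -natrX fcard_boundary_coloring -[#|[set _ | _]|]sum1_card.
  rewrite natr_sum mulr_sumr.
  rewrite big_mkcond; apply: eq_bigr => f _; rewrite inE mulr1.
  case: ifPn => [/forallP invf | /forallPn[[e b] /negPf neq_f]].
    rewrite -prodr_const big_mkcond; apply: eq_bigr => e _.
    have := (invf (e, true), invf (e, false)).
    rewrite /boundary_step /flipped /kept /= /Defs.opp /=.
    by case: ifP => _ [/eqP-> /eqP->]; rewrite !eqxx.
  rewrite (bigD1 e) //= [X in X * _](_ : _ = 0) ?mul0r //.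
  move: neq_f; rewrite /boundary_step /flipped /kept /= /Defs.opp /=.
  by case: ifP => _; case: b => /= ->; rewrite ?andbF ?oppr0.
rewrite exchange_big [RHS]big_mkcond; apply: eq_bigr => f _.
(* If the colors of the two ends agree, or those of their [rot] images, then [kept] and [flipped]
   coincide and cancel. *)
have local e : - (flipped f e)%:R + (kept f e)%:R =
    (if (f (e, true) != f (e, false)) &&
        (f (rot (e, true)) != f (rot (e, false)))
     then edge_sign f e else 0 : rat).
  rewrite /flipped /kept /edge_sign.
  by case: (f (e, true)); case: (f (e, false));
     case: (f (rot (e, true))); case: (f (rot (e, false))).
rewrite -bigA_distr (eq_bigr _ (fun e _ => local e)) {local}.
case: ifPn => [/forallP alt_f | /forallPn[[e b] not_alt]].
  by apply: eq_bigr => e _; rewrite (alt_f (e, false)).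
rewrite (bigD1 e) //= ifN ?mul0r //.
by case: b not_alt; rewrite /Defs.opp //= eq_sym [f (rot _) == _]eq_sym.
Qed.

Lemma sum_opp_invariant (k : D -> nat) : (forall d, k (opp d) = k d) ->
  \sum_d k d = (\sum_e k (e, true)).*2.
Proof.
move=> k_opp; rewrite (eq_bigr (fun d => k (d.1, d.2))) => [|[]//].
rewrite -(pair_bigA _ (fun e b => k (e, b))) -muln2 big_distrl.
apply: eq_bigr => e _; rewrite big_bool /= -(k_opp (e, true)) /Defs.opp /=.
by rewrite muln2 -addnn.
Qed.

(* The pointwise difference h of two alternating colorings is invariant under
   [opp], and so is h o rot; hence the half-sums of h and of h o rot over the
   edges coincide, and the two signs differ by an even power of -1. *)
Lemma prod_edge_sign_alternating f f' : alternating f -> alternating f' ->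
  \prod_e edge_sign f e = \prod_e edge_sign f' e.
Proof.
move=> /forallP alt_f /forallP alt_f'.
pose h (d : D) := f d (+) f' d.
have [h_opp h_rot] : (forall d, h (opp d) = h d) /\
    (forall d, h (rot (opp d)) = h (rot d)).
  split=> d; move: (alt_f d) (alt_f' d); rewrite /h;
  by do 8 case: (fun_of_fin _ _).
have sum_h : \sum_e (h (e, true) : nat) = \sum_e (h (rot (e, true)) : nat).
  apply: double_inj.
  rewrite -(sum_opp_invariant (fun d => h d)) => [|d]; last by rewrite h_opp.
  rewrite -(sum_opp_invariant (fun d => h (rot d))) => [|d].
    by rewrite (reindex_inj (@perm_inj _ rot)).
  by rewrite h_rot.
have : \prod_e (edge_sign f e * edge_sign f' e) = 1.
  transitivity ((-1) ^+ (\sum_e (h (e, true) : nat)) *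
                (-1) ^+ (\sum_e (h (rot (e, true)) : nat)) : rat).
    rewrite !expr_sum -big_split; apply: eq_bigr => e _.
    rewrite /edge_sign /h.
    by do 4 case: (fun_of_fin _ _).
  by rewrite sum_h -expr2 sqrr_sign.
have sq k : (\prod_e edge_sign k e) * (\prod_e edge_sign k e) = 1.
  rewrite -big_split big1 // => e _.
  by apply: (etrans (esym (expr2 _))); apply: sqrr_sign.
rewrite big_split /= => /(congr1 ( *%R^~ (\prod_e edge_sign f' e))).
by rewrite -mulrA sq mulr1 mul1r.
Qed.

(** * Strands of the medial diagram and alternating colorings *)

Lemma medial_arcK : involutive (@medial_arc G).
Proof. by case=> d []; rewrite /medial_arc /= ?permK ?permKV. Qed.

Lemma straight_aheadE (u : halfarc G) : straight_ahead u = (opp u.1, u.2).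
Proof. by case: u => d []. Qed.

Lemma straight_aheadK : involutive (@straight_ahead G).
Proof. by case=> d b; rewrite !straight_aheadE oppK. Qed.

Lemma same_strand_sym : connect_sym (@same_strand G).
Proof.
apply: sym_connect_sym => u w; rewrite /same_strand.
by rewrite ![w == _]eq_sym (inv_eq medial_arcK) (inv_eq straight_aheadK).
Qed.

(* The coloring of the half-edges is read off the clockwise half-arcs; the medial
   arcs carry it to the counterclockwise ones through [rot]. *)
Lemma card_invariant_strand_coloring :
  #|[set f : {ffun D -> bool} |
     [forall d, (f (opp d) == f d) && (f (rot (opp d)) == f (rot d))]]|
  = (2 ^ n_comp (@same_strand G) predT)%N.
Proof.
rewrite -(card_invariant_coloring _ _ same_strand_sym).
pose lift (f : {ffun D -> bool}) : {ffun halfarc G -> bool} :=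
  [ffun u => if u.2 then f (rot u.1) else f u.1].
have lift_inj : injective lift.
  move=> f g /ffunP efg; apply/ffunP => d.
  by have := efg (d, false); rewrite !ffunE.
rewrite -(card_imset _ lift_inj); apply: eq_card => F.
apply/imsetP/idP => [[f + ->]|]; rewrite !inE => /forallP inv_f.
  apply/forallP => u; apply/forallP => w; apply/implyP => /orP[]/eqP->.
    by case: u => d []; rewrite !ffunE /= ?permKV.
  rewrite straight_aheadE !ffunE /= eq_sym.
  by case: ifP; have /andP[] := inv_f u.1.
have F_med u : F (medial_arc u) = F u.
  have /forallP/(_ (medial_arc u)) := inv_f u.
  by rewrite /same_strand eqxx => /eqP.
have F_str d b : F (opp d, b) = F (d, b).
  have /forallP/(_ (straight_ahead (d, b))) := inv_f (d, b).
  by rewrite /same_strand eqxx orbT straight_aheadE => /eqP.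
have F_rot d : F (rot d, false) = F (d, true) by rewrite -[RHS]F_med.
exists [ffun d => F (d, false)].
  by rewrite inE; apply/forallP => d; rewrite !ffunE !F_rot !F_str !eqxx.
by apply/ffunP => -[d []]; rewrite !ffunE //= F_rot.
Qed.

Lemma alternating_exists : exists f, alternating f.
Proof.
(* As [q (rot d) = rot (opp d)], a coloring is alternating exactly when both [p] and [q] reverse
   it. *)
pose p : {perm D} := perm (inv_inj oppK); pose q := (p ^ rot)%g.
have qE d : q d = rot (opp ((rot^-1)%g d)) by rewrite /q /conjg !permM permE.
have [|d|d|d|f [f_p f_q]] := @fixfree_involutions_bicoloring _ p q.
- by move=> d; rewrite !permE oppK.
- by rewrite !qE permK oppK permKV.
- by rewrite permE opp_neq.
- by rewrite qE (canF_eq (permK _)) ?opp_neq //.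
exists f; apply/forallP => d; rewrite -[opp d](permE (inv_inj oppK)) f_p.
have := f_q (rot d); rewrite qE permK -[opp d](permE (inv_inj oppK)) => ->.
by case: (f d); case: (f (rot d)).
Qed.

(** Adding a fixed alternating coloring modulo 2 exchanges alternating and strand-invariant
    colorings. *)
Lemma card_alternating :
  #|[set f | alternating f]| = (2 ^ n_comp (@same_strand G) predT)%N.
Proof.
have [f0 /forallP alt_f0] := alternating_exists.
pose shift (f : {ffun D -> bool}) := [ffun d => f d (+) f0 d] : {ffun D -> bool}.
have shiftK : involutive shift.
  by move=> f; apply/ffunP => d; rewrite !ffunE addbK.
rewrite -card_invariant_strand_coloring -(card_imset _ (inv_inj shiftK)).
apply: eq_card => f; rewrite -[f in LHS]shiftK.
rewrite (mem_imset _ _ (inv_inj shiftK)) !inE.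
apply: eq_forallb => d; rewrite !ffunE; move: (alt_f0 d).
by do 8 case: (fun_of_fin _ _).
Qed.

End MedialDiagram.

(** * Evaluation of the polynomial *)

Theorem theorem3p1 (G : embedded_graph) (hG : connected_graph G) :
  `| BRT G (- 2 : rat) (- 2) (1 / 4) | = 2 ^ ((nb_link_components G)%:Z - 1).
Proof.
pose c := n_comp (@same_strand G) predT.
have norm_sum : `|\sum_(H : {set edge G})
    (-1) ^+ #|H| * 2 ^+ fcard (boundary_step H) predT : rat| = 2 ^+ c.
  have [f0 alt_f0] := alternating_exists G.
  rewrite state_sum_alternating.
  rewrite (eq_bigr (fun=> \prod_e edge_sign G f0 e)); last first.
    by move=> f alt_f; apply: prod_edge_sign_alternating.
  rewrite sumr_const (_ : #|_| = (2 ^ c)%N); last first.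
    by rewrite -card_alternating; apply: eq_card => f; rewrite inE.
  rewrite normrMn normr_prod big1 ?natrX // => e _; exact: normr_sign.
(* The last factor collects what does not depend on [H]: the parity of the vertex count, the
   isolated vertices and the exponent shift by -1. *)
have -> : BRT G (- 2 : rat) (- 2) (1 / 4) = \sum_(H : {set edge G})
    (-1) ^+ #|H| * 2 ^+ fcard (boundary_step H) predT
    * ((-1) ^+ #|vtx G| * 2 ^+ #|isolated G| * (- 2) ^ (- 1%:Z)).
  apply: eq_bigr => H _; rewrite BRT_term // expfzDr // mulrA; congr (_ * _).
  rewrite -[LHS]/((- 2) ^+ nb_faces H) exprNn -signr_odd odd_nb_faces.
  rewrite signr_addb !signr_odd /nb_faces exprD.
  by rewrite [X in X * _]mulrC mulrACA.
rewrite -mulr_suml normrM norm_sum !normrM normrX normrN1 expr1n mul1r normrX.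
rewrite normr_nat (_ : `|(- 2 : rat) ^ (- 1%:Z)| = 2 ^ (- 1%:Z)) //.
by rewrite mulrA -exprD /nb_link_components expfzDr.
Qed.
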